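(* Let $X$ be a real Banach space and let $f_0, f_k : X\to\mathbb{R}\cup\{+\infty\}$ ($k\ge 1$) be proper convex functions. Let $(\mathcal P)$ be the problem $\inf\{f_0(x) : x\in X,\ f_k(x)\le 0\ \forall k\ge 1\}$, with optimal value $v(\mathcal P)<+\infty$. Put $f:=\sup_{k\ge1}f_k$ and $f_\infty:=\limsup_{k\to\infty}f_k$ (pointwise). Suppose that $(\mathcal P)$ satisfies the Slater condition, i.e. there is $x_0\in\operatorname{dom}f_0$ with $\sup_{k\ge1}f_k(x_0)<0$, and that $f$ is continuous at some point in $\operatorname{dom}f_0$. Then $$v(\mathcal P_1^{**})=v(\mathcal P_2^{**})=v(\mathcal P),$$ where $(\mathcal P_1^{**})$ is the problem $$\inf\{f_0^{**}(z): z\in X^{**},\ f_k^{**}(z)\le0\ \forall k\ge1,\ f_\infty^{**}(z)\le0,\ z\in\operatorname{dom}f^{**}\}$$ and $(\mathcal P_2^{**})$ is the problem $$\inf\Big\{f_0^{**}(z): z\in X^{**},\ f_k^{**}(z)\le0\ \forall k\ge1,\ z\in\overline{\operatorname{dom}\big(\textstyle\sum_{k\ge1}f_k^+\big)}^{w^{**}}\Big\}.$$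
   Context: $X^*$ and $X^{**}$ are the dual and bidual of $X$, with $X\subset X^{**}$ canonically. $\operatorname{dom}h:=\{h<+\infty\}$ and $h^+:=\max\{h,0\}$. For $h:X\to\overline{\mathbb R}$: $h^*(x^* ):=\sup_{x\in X}(\langle x^*,x\rangle-h(x))$ for $x^*\in X^*$, and $h^{**}(z):=\sup_{x^*\in X^*}(\langle z,x^*\rangle-h^*(x^* ))$ for $z\in X^{**}$. $\overline{A}^{w^{**}}$ is the closure of $A\subset X^{**}$ in the weak-* topology $w^{**}=\sigma(X^{**},X^* )$. $(\sum_{k\ge1}h_k)(x):=\limsup_{m\to\infty}\sum_{k=1}^m h_k(x)$. $v(\cdot)$ denotes the optimal value of a minimization problem, equal to $+\infty$ if it is infeasible. $f_\infty(x):=\limsup_{k\to\infty}f_k(x)$ is regarded in the paper as a function $X\to\mathbb R\cup\{+\infty\}$; when the number of constraints is finite, one sets $f_\infty\equiv-\infty$ (so that $f_\infty^{**}\equiv-\infty$). *)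

(* Defs.v *)
From HB Require Import structures.
From mathcomp Require Import all_boot all_order all_algebra.
From mathcomp Require Import all_classical all_reals all_analysis.
Set Implicit Arguments.
Unset Strict Implicit.
Unset Printing Implicit Defensive.
Import Order.TTheory GRing.Theory Num.Theory.
Import numFieldNormedType.Exports.
Local Open Scope classical_set_scope.
Local Open Scope ring_scope.

Section Dual.
Variables (R : realType) (X : normedModType R).

Definition continuous_linear : {pred X -> R^o} :=
  mem [set u : X -> R^o | linear u /\ continuous u].

Lemma continuous_linear_submod : submod_closed continuous_linear.
Proof.
split=> [|a u v]; rewrite /in_mem /=.
  apply/mem_set; split=> [b x y /=|]; last exact: cst_continuous.
  by rewrite /GRing.zero /= scaler0 addr0.
move=> /set_mem[lu cu] /set_mem[lv cv]; apply/mem_set; split=> [b x y|x].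
  rewrite -[LHS]/(a *: u (b *: x + y) + v (b *: x + y)).
  rewrite -[RHS]/(b *: (a *: u x + v x) + (a *: u y + v y)).
  by rewrite lu lv !scalerDr !scalerA [b * a]mulrC addrACA.
apply: (@continuousD _ _ _ (a *: u) v); last exact: cv.
by apply: continuousZl_tmp; exact: cu.
Qed.

HB.instance Definition _ := GRing.isSubmodClosed.Build R (X -> R^o)
  continuous_linear continuous_linear_submod.

Record dual := Dual {
  dual_fun :> X -> R^o;
  dual_funP : dual_fun \in continuous_linear }.

HB.instance Definition _ := [isSub of dual for dual_fun].
HB.instance Definition _ := [Choice of dual by <:].
HB.instance Definition _ := [SubChoice_isSubLmodule of dual by <:].

Lemma dual_linear (u : dual) : linear u.
Proof. by have /set_mem[] := dual_funP u. Qed.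

Lemma dual_continuous (u : dual) : continuous u.
Proof. by have /set_mem[] := dual_funP u. Qed.

HB.instance Definition _ (u : dual) :=
  GRing.isLinear.Build R X R^o _ (dual_fun u) (@dual_linear u).

Definition dual_norm (u : dual) : R :=
  sup [set `|u x| | x in [set x : X | `|x| <= 1]].

Lemma dual_has_sup (u : dual) :
  has_sup [set `|u x| | x in [set x : X | `|x| <= 1]].
Proof.
split; first by exists `|u 0|, 0 => //=; rewrite normr0.
have /bounded_funP/(_ 1)[M uM] :=
  continuous_linear_bounded 0 (@dual_continuous u 0).
by exists M => _ [x x1 <-]; exact: uM.
Qed.

Lemma dual_norm_ub (u : dual) (x : X) : `|u x| <= dual_norm u * `|x|.
Proof.
have [->|x0] := eqVneq x 0; first by rewrite linear0 !normr0 mulr0.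
rewrite -ler_pdivrMr ?normr_gt0//; apply: (sup_ubound (dual_has_sup u).2).
exists (`|x|^-1 *: x); first by rewrite /= normrZ normfV normr_id mulVf ?normr_eq0.
by rewrite linearZ /= normrZ normfV normr_id mulrC.
Qed.

Lemma dual_norm_le (u : dual) (M : R) :
  (forall x, `|x| <= 1 -> `|u x| <= M) -> dual_norm u <= M.
Proof.
by move=> uM; apply: ge_sup; [exact: (dual_has_sup u).1|move=> _ [x /uM ? <-]].
Qed.

Lemma dual_norm_ge0 (u : dual) : 0 <= dual_norm u.
Proof.
by apply: (sup_ubound (dual_has_sup u).2); exists 0; rewrite /= ?linear0 ?normr0.
Qed.

Lemma dual_normD (u v : dual) : dual_norm (u + v) <= dual_norm u + dual_norm v.
Proof.
apply: dual_norm_le => x x1; apply: le_trans (ler_normD _ _) _.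
by apply: lerD; apply: (le_trans (dual_norm_ub _ _));
  rewrite -[leRHS]mulr1 ler_wpM2l// dual_norm_ge0.
Qed.

Lemma dual_normZ_le (a : R) (u : dual) :
  dual_norm (a *: u) <= `|a| * dual_norm u.
Proof.
apply: dual_norm_le => x x1.
rewrite -[(a *: u) x]/(a *: u x) normrZ ler_wpM2l//.
apply: (le_trans (dual_norm_ub _ _)).
by rewrite -[leRHS]mulr1 ler_wpM2l// dual_norm_ge0.
Qed.

Lemma dual_normZ (a : R) (u : dual) : dual_norm (a *: u) = `|a| * dual_norm u.
Proof.
apply/eqP; rewrite eq_le dual_normZ_le /=.
have [->|a0] := eqVneq a 0; first by rewrite normr0 mul0r dual_norm_ge0.
have := dual_normZ_le a^-1 (a *: u).
by rewrite scalerA mulVf// scale1r normfV mulrC ler_pdivlMr ?normr_gt0// mulrC.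
Qed.

Lemma dual_norm0_eq0 (u : dual) : dual_norm u = 0 -> u = 0.
Proof.
move=> u0; apply: val_inj; apply/funext => x /=; apply/normr0_eq0/eqP.
by rewrite eq_le normr_ge0 andbT -[leRHS](mul0r `|x|) -u0 dual_norm_ub.
Qed.

HB.instance Definition _ := Lmodule_isNormed.Build R dual
  dual_normD dual_normZ dual_norm0_eq0.

End Dual.

Notation bidual X := (dual (dual X)).

(* The dual of Y carrying sigma(dual Y, Y), i.e. the topology induced by
   pointwise convergence on Y, instead of the norm topology of [dual Y]. *)
Definition weak_star (R : realType) (Y : normedModType R) : topologicalType :=
  initial_topology (fun u : dual Y => (u : {ptws Y -> R})).

Definition weak_star_closure (R : realType) (Y : normedModType R)
  (A : set (dual Y)) : set (dual Y) :=
  @closure (weak_star Y) A.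

Section Canonical.
Variables (R : realType) (X : normedModType R).

Lemma evaluation_subproof (x : X) :
  (fun u : dual X => u x : R^o) \in @continuous_linear R (dual X).
Proof.
have lx : linear (fun u : dual X => u x : R^o) by [].
pose L : {linear dual X -> R^o} := HB.pack (fun u : dual X => u x : R^o)
  (GRing.isLinear.Build R (dual X) R^o _ (fun u : dual X => u x : R^o) lx).
apply/mem_set; split => //.
apply: (@bounded_linear_continuous _ _ _ L); apply/bounded_funP => r.
exists (r * `|x|) => u ur; apply: (le_trans (dual_norm_ub u x)).
by rewrite ler_wpM2r.
Qed.

Definition canonical_embedding (x : X) : bidual X :=
  Dual (evaluation_subproof x).

End Canonical.

Local Open Scope ereal_scope.

Section Conjugate.
Variables (R : realType).

Definition proper_efun (T : Type) (h : T -> \bar R) : Prop :=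
  (forall x, -oo < h x) /\ (exists x, h x < +oo).

Definition convex_efun (E : lmodType R) (h : E -> \bar R) : Prop :=
  forall (x y : E) (t : R), (0 <= t <= 1)%R ->
    h (t *: x + (1 - t) *: y)%R <= t%:E * h x + (1 - t)%:E * h y.

Definition edom (T : Type) (h : T -> \bar R) : set T := [set x | h x < +oo].

Definition conjugate (X : normedModType R) (h : X -> \bar R) :
    dual X -> \bar R :=
  fun u => ereal_sup [set (u x)%:E - h x | x in [set: X]].

Definition biconjugate (X : normedModType R) (h : X -> \bar R) :
    bidual X -> \bar R :=
  conjugate (conjugate h).

(* +oo when [feasible] is empty, as [ereal_inf set0 = +oo]. *)
Definition optimal_value (T : Type) (obj : T -> \bar R) (feasible : set T) :
    \bar R :=
  ereal_inf [set obj x | x in feasible].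

End Conjugate.

(* Constraints are numbered from 1; [N] is [Some n] when there are n of them
   and [None] when there are infinitely many. *)
Definition constraint (N : option nat) : pred nat :=
  fun k => (0 < k)%N && (if N is Some n then (k <= n)%N else true).

Section Problems.
Variables (R : realType) (X : normedModType R) (N : option nat).
Variables (f0 : X -> \bar R) (f : nat -> X -> \bar R).

Definition sup_fun : X -> \bar R :=
  fun x => ereal_sup [set f k x | k in [set k | constraint N k]].

(* With finitely many constraints the limit function is -oo by convention, so
   that its biconjugate is -oo and the condition bearing on it is void. *)
Definition limsup_fun : X -> \bar R :=
  fun x => if N is Some _ then -oo else limn_esup (fun k => f k x).

Definition sum_fun (h : nat -> X -> \bar R) : X -> \bar R :=
  fun x => limn_esup (fun m => \sum_(1 <= k < m.+1 | constraint N k) h k x).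

Definition value_P : \bar R :=
  optimal_value f0 [set x | forall k, constraint N k -> f k x <= 0].

Definition value_P1 : \bar R :=
  optimal_value (biconjugate f0)
    [set z | [/\ forall k, constraint N k -> biconjugate (f k) z <= 0,
                 biconjugate limsup_fun z <= 0
               & edom (biconjugate sup_fun) z]].

Definition value_P2 : \bar R :=
  optimal_value (biconjugate f0)
    [set z | (forall k, constraint N k -> biconjugate (f k) z <= 0) /\
             weak_star_closure
               (@canonical_embedding R X @` edom (sum_fun (fun k => (f k)^\+)))
               z].

End Problems.

(* Main.v *)
Require Import Defs.
From HB Require Import structures.
From mathcomp Require Import all_boot all_order all_algebra.
From mathcomp Require Import all_classical all_reals all_analysis.
From mathcomp Require Import ring lra.
Set Implicit Arguments.
Unset Strict Implicit.
Unset Printing Implicit Defensive.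
Import Order.TTheory GRing.Theory Num.Theory.
Import numFieldNormedType.Exports.
Local Open Scope classical_set_scope.
Local Open Scope ring_scope.

(** Only the lower bounds on the two biconjugate problems need an argument.  Let
    [v = v(P)] be finite and let [g_m := sup_(k >= m) f_k].  The Slater condition
    gives [s_0 >= 0] with [v <= f0 + s_0 g_0].  Since [g_m = max(f_m, g_(m+1))],
    a two-function minimax splits [s_m g_m] into [l_m f_m + s_(m+1) g_(m+1)],
    and Hahn-Banach replaces [l_m f_m] by a continuous affine minorant.
    Iterating, [v <= f0 + A_m + s_m g_m], where [A_m] is affine and its
    increments lie below [l_m f_m], hence are nonpositive at any [z] at which
    the biconjugates of all [f_k] are.  As the [f_k] are bounded above by a
    negative constant on a common ball, the increments are summable in the norm
    of the dual, so [A_m] converges and [v <= f0 + A + s f_oo] on [dom f].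
    For the second problem, [f_oo <= 0] on the domain of the sum; for the first,
    one more affine minorant, of [s f_oo], is extracted.  In both cases the
    remaining domain constraint is separated off, and the affine minorant of
    [f0] so obtained bounds its biconjugate at [z] from below by [v].

    Convex functions enter through their epigraphs [x, r |-> h x <= r%:E], so
    that infinite values need no separate treatment. *)

(** * Hahn-Banach and separation *)

(** Homogeneity is asked only as an inequality; applying it to [t^-1] as well gives equality. *)
Definition sublinear (R : realType) (X : lmodType R) (p : X -> R) : Prop :=
  (forall x y, p (x + y) <= p x + p y) /\
  (forall t x, 0 < t -> p (t *: x) <= t * p x).

Lemma sublinear0 (R : realType) (X : lmodType R) (p : X -> R) :
  sublinear p -> p 0 = 0.
Proof.
move=> [_ pZ].
have := pZ 2 0 (ltr0Sn _ _); have := pZ 2^-1 0; rewrite !scaler0 invr_gt0.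
by move=> /(_ (ltr0Sn _ _)); lra.
Qed.

Lemma sublinear_homog (R : realType) (X : lmodType R) (p : X -> R) t x :
  sublinear p -> 0 < t -> p (t *: x) = t * p x.
Proof.
move=> [_ pZ] t0; apply/eqP; rewrite eq_le pZ//= -ler_pdivlMl//.
apply: le_trans (pZ _ _ _); last by rewrite invr_gt0.
by rewrite scalerA mulVf ?gt_eqF// scale1r.
Qed.

Lemma sublinear_opp (R : realType) (X : lmodType R) (p : X -> R) x :
  sublinear p -> - p (- x) <= p x.
Proof.
by move=> sp; have := sp.1 x (- x); rewrite subrr sublinear0//; lra.
Qed.

(* A minimal sublinear functional below [p], given by Zorn's lemma, is linear. *)
Lemma hahn_banach (R : realType) (X : lmodType R) (p : X -> R) :
  sublinear p ->
  exists u : X -> R^o, linear u /\ forall x, u x <= p x.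
Proof.
move=> sp.
pose S q := sublinear q /\ forall x, q x <= p x.
pose T := {q : X -> R | S q}.
pose below (s t : T) := `[< forall x, sval t x <= sval s x >].
have Sp : S p by split.
have [||A tA|[q [sq qp]] q_min] := @ZL_preorder T (exist S p Sp) below.
- by move=> t; apply/asboolP.
- move=> r s t /asboolP sr /asboolP ts; apply/asboolP => x.
  exact: le_trans (ts x) (sr x).
- have [[s0 As0]|A0] := pselect (A !=set0); last first.
    by exists (exist S p Sp) => s As; exfalso; apply: A0; exists s.
  pose V x : set R := [set sval s x | s in A].
  have V_neq0 x : V x !=set0 by exists (sval s0 x), s0.
  have V_lb x : has_lbound (V x).
    exists (- p (- x)) => _ [s As <-]; have [ss sp'] := svalP s.
    by apply: le_trans (sublinear_opp _ ss); rewrite lerN2.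
  have le_V x s : A s -> inf (V x) <= sval s x.
    by move=> As; apply: ge_inf => //; exists s.
  have qP : S (fun x => inf (V x)).
    split; last first.
      by move=> x; apply: le_trans (le_V x s0 As0) _; exact: (svalP s0).2.
    split=> [x y|t x t0].
      rewrite -lerBlDr; apply: lb_le_inf => // _ [s1 As1 <-].
      rewrite lerBlDr -lerBlDl; apply: lb_le_inf => // _ [s2 As2 <-].
      rewrite lerBlDl.
      have [s12|s21] := tA _ _ As1 As2.
        have := (svalP s2).1.1 x y; have := le_V (x + y) _ As2.
        by move/asboolP: s12 => /(_ x); lra.
      have := (svalP s1).1.1 x y; have := le_V (x + y) _ As1.
      by move/asboolP: s21 => /(_ y); lra.
    rewrite -ler_pdivrMl//; apply: lb_le_inf => // _ [s As <-].
    rewrite ler_pdivrMl//; apply: le_trans (le_V _ _ As) _.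
    exact: (svalP s).1.2.
  by exists (exist S _ qP) => s As; apply/asboolP => x /=; exact: le_V.
(* Minimality of [q] against [x |-> inf_(t > 0) (q (x + t y) - t q y)]. *)
have qB x y : q x <= q (x + y) - q y.
  pose V x : set R := [set q (x + t *: y) - t * q y | t in [set t | 0 < t]].
  have V_neq0 x' : V x' !=set0 by exists (q (x' + 1 *: y) - 1 * q y), 1 => /=.
  have V_lb x' : has_lbound (V x').
    exists (- q (- x')) => _ [t /= t0 <-].
    have := sq.1 (x' + t *: y) (- x').
    by rewrite addrC addKr sublinear_homog//; lra.
  have le_V x' t : 0 < t -> inf (V x') <= q (x' + t *: y) - t * q y.
    by move=> t0; apply: ge_inf => //; exists t.
  have V_le_q x' : inf (V x') <= q x'.
    have := le_V x' 1 ltr01; have := sq.1 x' (1 *: y).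
    by rewrite scale1r; lra.
  have rP : S (fun x => inf (V x)).
    split; last by move=> x'; exact: le_trans (V_le_q _) (qp _).
    split=> [a b|t a t0].
      rewrite -lerBlDr; apply: lb_le_inf => // _ [t1 /= t10 <-].
      rewrite lerBlDr -lerBlDl; apply: lb_le_inf => // _ [t2 /= t20 <-].
      have := le_V (a + b) (t1 + t2) (addr_gt0 t10 t20).
      have := sq.1 (a + t1 *: y) (b + t2 *: y).
      by rewrite addrACA -scalerDl; lra.
    rewrite -ler_pdivrMl//; apply: lb_le_inf => // _ [t1 /= t10 <-].
    rewrite ler_pdivrMl//; apply: le_trans (le_V _ _ (mulr_gt0 t0 t10)) _.
    by rewrite -scalerA -scalerDr sublinear_homog// mulrBr mulrA.
  have /asboolP/(_ x)/= := q_min (exist S _ rP) (asboolT V_le_q).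
  by move=> /le_trans; apply; have := le_V x 1 ltr01; rewrite scale1r mul1r.
have qD x y : q (x + y) = q x + q y by have := qB x y; have := sq.1 x y; lra.
have qN x : q (- x) = - q x.
  by have := qD x (- x); rewrite subrr sublinear0//; lra.
exists q; split => // a x y; rewrite qD; congr (_ + _).
have [a0|a0|->] := ltrgt0P a.
- exact: sublinear_homog.
- by rewrite -[a]opprK scaleNr qN sublinear_homog ?oppr_gt0// scaleNr.
- by rewrite !scale0r sublinear0.
Qed.

(** [C] is read as a subset of the product of [E] and the real line, typically an epigraph. *)
Definition convex_rel (R : realType) (E : lmodType R) (C : E -> R -> Prop) :=
  forall x y r s t, 0 <= t <= 1 -> C x r -> C y s ->
    C (t *: x + (1 - t) *: y) (t * r + (1 - t) * s).

(** A point with [p < 0] forces [t >= p / (p - q)], a point with [q < 0] forces [t <= p / (p - q)].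
    Convexity makes the two demands compatible, so the supremum of the lower bounds serves as
    [t]. *)
Lemma plane_separation (R : realType) (G : R^o -> R -> Prop) :
  convex_rel G -> (forall p q, G p q -> 0 <= p \/ 0 <= q) ->
  exists2 t : R, 0 <= t <= 1 & forall p q, G p q -> 0 <= (1 - t) * p + t * q.
Proof.
move=> Gconv Gpos.
(* Including 0 keeps the supremum defined and nonnegative when no point has [p < 0]. *)
pose V : set R := [set l | l = 0 \/ exists p q, [/\ G p q, p < 0 & l = p / (p - q)]].
have V0 : V 0 by left.
have V_le1 l : V l -> l <= 1.
  move=> [->//|[p [q [Gpq p0 ->]]]].
  have q0 : 0 <= q by case: (Gpos _ _ Gpq) => //; lra.
  by rewrite ler_ndivrMr ?mul1r; lra.
have V_ub : has_ubound V by exists 1.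
exists (sup V).
  by rewrite (ub_le_sup V_ub V0) ge_sup//; exists 0.
move=> p q Gpq.
have [p0|p0] := ltP p 0.
  have q0 : 0 <= q by case: (Gpos _ _ Gpq) => //; lra.
  have : p / (p - q) <= sup V by apply: ub_le_sup => //; right; exists p, q.
  by rewrite ler_ndivrMr; [lra|lra].
have [q0|q0] := leP 0 q.
  have := ub_le_sup V_ub V0.
  have : sup V <= 1 by rewrite ge_sup//; exists 0.
  by move=> s1 s0; apply: addr_ge0; apply: mulr_ge0 => //; lra.
suff : sup V <= p / (p - q) by rewrite ler_pdivlMr; [lra|lra].
apply: ge_sup; first by exists 0.
move=> _ [->|[p' [q' [Gpq' p'0 ->]]]]; first by apply: divr_ge0; lra.
have q'0 : 0 <= q' by case: (Gpos _ _ Gpq') => //; lra.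
(* The weight [(p - q) / S] selects the point of the segment on the diagonal; [Gpos] makes its
   common coordinate nonnegative. *)
pose S := q' - p' + p - q.
have S0 : 0 < S by rewrite /S; lra.
have Sn0 : q' - p' + p - q != 0 by apply: lt0r_neq0.
have t01 : 0 <= (p - q) / S <= 1.
  by rewrite divr_ge0 ?ler_pdivrMr//; rewrite /S; lra.
have := Gpos _ _ (Gconv _ _ _ _ _ t01 Gpq' Gpq).
have -> : ((p - q) / S *: (p' : R^o) + (1 - (p - q) / S) *: (p : R^o))%R =
    (q' * p - p' * q) / S.
  by rewrite /GRing.scale /= /S; field.
have -> : (p - q) / S * q' + (1 - (p - q) / S) * q = (q' * p - p' * q) / S - 0 * q.
  by rewrite /S; field.
rewrite mul0r subr0 => H.
have {H} : 0 <= (q' * p - p' * q) / S by case: H.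
rewrite pmulr_lge0 ?invr_gt0// => H.
rewrite ler_ndivrMr; last lra.
by rewrite mulrAC ler_pdivrMr; lra.
Qed.

Lemma dual_of_bounded (R : realType) (X : normedModType R) (u : X -> R^o)
    (M : R) :
  linear u -> (forall x, `|u x| <= M * `|x|) ->
  exists v : dual X, forall x, v x = u x.
Proof.
move=> lu uM.
pose L : {linear X -> R^o} := HB.pack u (GRing.isLinear.Build R X R^o _ u lu).
suff cu : u \in @continuous_linear R X by exists (Dual cu).
apply/mem_set; split => //; apply: (@bounded_linear_continuous _ _ _ L).
apply/bounded_funP => r; exists (`|M| * r) => x xr.
apply: le_trans (uM x) _; apply: le_trans (ler_wpM2r (normr_ge0 _) (ler_norm M)) _.
by rewrite ler_wpM2l.
Qed.

Section Sandwich.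
Variables (R : realType) (X : normedModType R) (C1 C2 : X -> R -> Prop).
Variables (xb : X) (rho c M v : R).
Hypotheses (C1_convex : convex_rel C1) (C2_convex : convex_rel C2).
Hypotheses (C1_xb : C1 xb c) (rho_gt0 : 0 < rho).
Hypothesis C2_ball : forall x, `|x - xb| < rho -> C2 x M.
Hypothesis le_v : forall x r s, C1 x r -> C2 x s -> v <= r + s.

(* [inf (V h)] is the directional derivative at 0 along [h] of the value
   function [h |-> inf {r + s | C1 x r, C2 (x + h) s}], with its value at 0
   replaced by the lower bound [v]. *)
Let V (h : X) : set R := [set l | exists t x r s,
  [/\ 0 < t, C1 x r, C2 (x + t *: h) s & l = t^-1 * (r + s - v)]].

Let V_opp h l l' : V h l -> V (- h) l' -> 0 <= l + l'.
Proof.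
move=> [t [x [r [s [t0 Cr Cs ->]]]]] [t' [x' [r' [s' [t'0 Cr' Cs' ->]]]]].
have tt0 : 0 < t + t' by apply: addr_gt0.
have ttn : t + t' != 0 by rewrite gt_eqF.
(* Weights proportional to [t'] and [t] make the displacements along [h] and [- h] cancel. *)
have th : 0 <= t' / (t + t') <= 1.
  by rewrite divr_ge0 ?ler_pdivrMr ?mul1r ?lerDr ?ltW.
have := C2_convex th Cs Cs'.
have -> : (t' / (t + t')) *: (x + t *: h) +
    (1 - t' / (t + t')) *: (x' + t' *: - h) =
    (t' / (t + t')) *: x + (1 - t' / (t + t')) *: x'.
  rewrite !scalerDr !scalerN !scalerA addrACA.
  rewrite (_ : (1 - t' / (t + t')) * t' = t' / (t + t') * t); last by field.
  by rewrite subrr addr0.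
move=> /(le_v (C1_convex th Cr Cr')) H.
have tn : t != 0 by rewrite gt_eqF.
have t'n : t' != 0 by rewrite gt_eqF.
have -> : t^-1 * (r + s - v) + t'^-1 * (r' + s' - v) =
  ((t + t') / (t * t')) * ((t' / (t + t') * r + (1 - t' / (t + t')) * r') +
  (t' / (t + t') * s + (1 - t' / (t + t')) * s') - v).
  by field; rewrite tn t'n ttn.
by rewrite mulr_ge0 ?subr_ge0// divr_ge0 ?mulr_ge0 ?ltW.
Qed.

Let V_bound h t : 0 < t -> t * `|h| < rho -> V h (t^-1 * (c + M - v)).
Proof.
move=> t0 th; exists t, xb, c, M; split => //; apply: C2_ball.
by rewrite addrC addKr normrZ gtr0_norm.
Qed.

Let V_neq0 h : V h !=set0.
Proof.
exists ((rho / (`|h| + 1))^-1 * (c + M - v)); apply: V_bound.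
  by rewrite divr_gt0 ?ltr_wpDl.
rewrite mulrAC ltr_pdivrMr ?ltr_wpDl//.
by rewrite mulrDr mulr1 ltrDl.
Qed.

Let V_lb h : has_lbound (V h).
Proof.
have [l' Vl'] := V_neq0 (- h).
by exists (- l') => l Vl; rewrite -subr_ge0 opprK; exact: V_opp Vl Vl'.
Qed.

Let V_inf h l : V h l -> inf (V h) <= l.
Proof. by move=> Vl; exact: ge_inf. Qed.

Let V_sublinear : sublinear (fun h => inf (V h)).
Proof.
split=> [h h'|t h t0].
  rewrite -lerBlDr; apply: lb_le_inf => // _ [t [x [r [s [t0 Cr Cs ->]]]]].
  rewrite lerBlDr -lerBlDl.
  apply: lb_le_inf => // _ [t' [x' [r' [s' [t'0 Cr' Cs' ->]]]]].
  rewrite lerBlDl; apply: V_inf.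
  have tt0 : 0 < t + t' by apply: addr_gt0.
  have ttn : t + t' != 0 by rewrite gt_eqF.
  have tn : t != 0 by rewrite gt_eqF.
  have t'n : t' != 0 by rewrite gt_eqF.
  have th : 0 <= t' / (t + t') <= 1.
    by rewrite divr_ge0 ?ler_pdivrMr ?mul1r ?lerDr ?ltW.
  (* With the same weights the two displacements add up to a single one of length
     [t * t' / (t + t')] along [h + h']. *)
  exists (t * t' / (t + t')), ((t' / (t + t')) *: x + (1 - t' / (t + t')) *: x').
  exists (t' / (t + t') * r + (1 - t' / (t + t')) * r').
  exists (t' / (t + t') * s + (1 - t' / (t + t')) * s').
  split.
  - by rewrite divr_gt0 ?mulr_gt0.
  - exact: C1_convex.
  - have := C2_convex th Cs Cs'; congr (C2 _ _).
    rewrite !scalerDr !scalerA addrACA; congr (_ + (_ + _)); congr (_ *: _).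
      by field.
    by field.
  - by field; rewrite tn t'n ttn.
rewrite -ler_pdivrMl//; apply: lb_le_inf => // _ [t' [x [r [s [t'0 Cr Cs ->]]]]].
rewrite ler_pdivrMl//; apply: V_inf; exists (t' / t), x, r, s; split => //.
- exact: divr_gt0.
- by rewrite scalerA divfK// gt_eqF.
- by rewrite invf_div mulrA.
Qed.

(** A linear functional below the directional derivative acts as a subgradient at 0 of the value
    function. It is continuous because [C2] holds with the constant [M] on a ball, and [a] is the
    largest constant keeping the affine function below [C2]. *)
Lemma sandwich : exists (u : dual X) (a : R),
  (forall x r, C2 x r -> u x + a <= r) /\
  (forall x r, C1 x r -> v <= r + (u x + a)).
Proof.
have [u0 [lu0 u0_le]] := hahn_banach V_sublinear.
have cMv : 0 <= c + M - v.
  rewrite subr_ge0; apply: (le_v C1_xb); apply: C2_ball.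
  by rewrite subrr normr0.
(* Half the radius keeps the displaced point strictly inside the ball. *)
pose K := (rho / 2)^-1 * (c + M - v).
have u0K x : u0 x <= K * `|x|.
  apply: le_trans (u0_le x) _.
  have [->|x0] := eqVneq x 0.
    by rewrite (sublinear0 V_sublinear) normr0 mulr0.
  have nx : 0 < `|x| by rewrite normr_gt0.
  have := @V_bound x (rho / 2 / `|x|).
  rewrite !divr_gt0// divfK ?gt_eqF// => /(_ isT) H.
  have {H} /V_inf : V x ((rho / 2 / `|x|)^-1 * (c + M - v)).
    by apply: H; rewrite ltr_pdivrMr// ltr_pMr// ltr1n.
  by rewrite (_ : _ * (c + M - v) = K * `|x|)// invf_div /K; ring.
pose L : {linear X -> R^o} := HB.pack u0 (GRing.isLinear.Build R X R^o _ u0 lu0).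
have [u uE] : exists u : dual X, forall x, u x = u0 x.
  apply: (@dual_of_bounded _ _ _ K) => // x; rewrite ler_norml u0K andbT.
  by rewrite lerNl; have := u0K (- x); rewrite normrN -[u0]/(L : X -> R^o) linearN.
have uV x y r s : C1 x r -> C2 y s -> u y - u x <= r + s - v.
  move=> Cr Cs; have -> : u y - u x = u0 (y - x) by rewrite -uE linearB.
  apply: le_trans (u0_le _) _.
  apply: V_inf; exists 1, x, r, s; rewrite scale1r subrKC invr1 mul1r.
  by split.
pose W : set R := [set l | exists y s, C2 y s /\ l = s - u y].
have W_lb x r : C1 x r -> lbound W (v - r - u x).
  by move=> Cr _ [y [s [Cs ->]]]; have := uV _ _ _ _ Cr Cs; lra.
have W0 : W !=set0.
  exists (M - u xb), xb, M; split => //; apply: C2_ball.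
  by rewrite subrr normr0.
exists u, (inf W); split => [x r Cr|x r Cr].
  rewrite -lerBrDl; apply: ge_inf; last by exists x, r.
  by exists (v - c - u xb); exact: W_lb.
by rewrite -lerBlDl -lerBlDl; apply: lb_le_inf => //; exact: W_lb.
Qed.

End Sandwich.

(** * Biconjugates *)

Section Biconjugate.
Variables (R : realType) (X : normedModType R).
Local Open Scope ereal_scope.

(** An affine minorant says [conjugate h u <= - a], and the term at [u] of the supremum defining the
    biconjugate is then at least [z u + a]. *)
Lemma biconjugate_ge (h : X -> \bar R) (u : dual X) (a : R) (z : bidual X) :
  (forall x r, h x <= r%:E -> (u x + a <= r)%R) ->
  (z u + a)%:E <= biconjugate h z.
Proof.
move=> uh; have hu : conjugate h u <= (- a)%:E.
  apply: ge_ereal_sup => _ [x _ <-].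
  case hx : (h x) => [r| |].
  - by rewrite -EFinB lee_fin; have := uh x r; rewrite hx => /(_ (lexx _)); lra.
  - by rewrite leNye.
  - by exfalso; have := uh x (u x + a - 1)%R; rewrite hx leNye => /(_ isT); lra.
apply: le_ereal_sup_tmp; exists ((z u)%:E - conjugate h u); first by exists u.
by rewrite EFinD leeD2l// leeNr -EFinN.
Qed.

Lemma biconjugate_canonical (h : X -> \bar R) (x : X) :
  biconjugate h (canonical_embedding x) <= h x.
Proof.
apply: ge_ereal_sup => _ [u _ <-] /=.
have : (u x)%:E - h x <= conjugate h u by apply: ereal_sup_ubound; exists x.
case: (h x) => [r| |]; last 2 first.
- by rewrite leey.
- by rewrite /= addey// leye_eq => /eqP ->; rewrite leNye.
case: (conjugate h u) => [s| |] //=; rewrite ?leNye//.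
by rewrite -!EFinB !lee_fin; lra.
Qed.

Lemma biconjugate_le0_affine (h : X -> \bar R) (u : dual X) (a l : R)
    (z : bidual X) :
  (0 < l)%R -> (forall x r, h x <= r%:E -> (u x + a <= l * r)%R) ->
  biconjugate h z <= 0 -> (z u + a <= 0)%R.
Proof.
move=> l0 uh hz.
have : (z (l^-1 *: u) + l^-1 * a)%:E <= biconjugate h z.
  apply: biconjugate_ge => x r /uh H.
  by rewrite -[(l^-1 *: u) x]/(l^-1 * u x)%R -mulrDr ler_pdivrMl.
move=> /le_trans/(_ hz); rewrite lee_fin linearZ /= -mulrDr.
by rewrite pmulr_rle0// invr_gt0.
Qed.

(** Adding any positive multiple of [u + a] to the minorant [w + b] leaves a minorant. If [z u + a]
    were positive, large multiples would make the biconjugate infinite at [z]. *)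
Lemma biconjugate_dom_affine (h : X -> \bar R) (w u : dual X) (b a : R)
    (z : bidual X) :
  (forall x r, h x <= r%:E -> (w x + b <= r)%R) ->
  (forall x, h x < +oo -> (u x + a <= 0)%R) ->
  biconjugate h z < +oo -> (z u + a <= 0)%R.
Proof.
move=> wh uh hz; rewrite leNgt; apply/negP => zu.
have H t : (0 <= t)%R -> (z (w + t *: u) + (b + t * a))%:E <= biconjugate h z.
  move=> t0; apply: biconjugate_ge => x r hr.
  have ux := uh x (le_lt_trans hr (ltry _)).
  have := wh x r hr; have := mulr_ge0_le0 t0 ux.
  by rewrite -[(w + t *: u)%R x]/(w x + t * u x)%R; lra.
move: hz H; case: (biconjugate h z) => [B _ H| // |_ H]; last first.
  by have := H _ (lexx 0%R); rewrite leeNy_eq.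
have {}H t : (0 <= t -> t * (z u + a) <= B - z w - b)%R.
  by move=> /H; rewrite lee_fin linearD linearZ /= /GRing.scale /=; lra.
have := H ((`|B - z w - b| + 1) / (z u + a))%R.
rewrite divfK ?gt_eqF// => /(_ (divr_ge0 (addr_ge0 (normr_ge0 _) ler01) (ltW zu))).
by have := ler_norm (B - z w - b)%R; lra.
Qed.

(** Evaluation at [u] is weak-* continuous, so the half-space it defines is closed. *)
Lemma weak_star_closure_affine (A : set X) (u : dual X) (a : R)
    (z : bidual X) :
  (forall x, A x -> u x + a <= 0)%R ->
  weak_star_closure (@canonical_embedding R X @` A) z -> (z u + a <= 0)%R.
Proof.
move=> uA zA.
pose ev : weak_star (dual X) -> R := fun z => z u.
have cev : continuous ev.
  pose emb : weak_star (dual X) -> {ptws dual X -> R} := fun w => w.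
  have cemb : continuous emb by exact: initial_continuous.
  pose pr : {ptws dual X -> R} -> R := fun g => g u.
  have cpr : continuous pr by exact: (@proj_continuous _ (fun=> R) u).
  by move=> y; exact: (continuous_comp (cemb y) (cpr (emb y))).
pose B := ev @^-1` [set r | r <= - a]%R.
have Bcl : closed B.
  by apply: closed_comp => [y _|]; [exact: cev|exact: closed_le].
suff : B z by rewrite /B /= /ev; lra.
rewrite ((closure_id B).1 Bcl); apply: closure_subset zA.
by move=> _ [x Ax <-]; rewrite /B /= /ev /=; have := uA x Ax; lra.
Qed.
End Biconjugate.

(** The monotone bounded sequence [l] controls the increments uniformly on the unit ball.
    Convergence thus holds in the dual norm, which lets elements of the bidual pass to the limit. *)
Lemma dual_limit (R : realType) (X : normedModType R) (U : nat -> dual X)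
    (l : R^nat) (C : R) :
  (forall m x, `|U m.+1 x - U m x| <= `|x| * (l m - l m.+1)) ->
  (forall m, l m.+1 <= l m) -> (forall m, C <= l m) ->
  exists u : dual X, (forall x, U ^~ x @ \oo --> (u x : R)) /\
    forall z : bidual X, (z \o U) @ \oo --> (z u : R).
Proof.
move=> Ul l_dec Cl.
have Umn m n x : (m <= n)%N -> `|U n x - U m x| <= `|x| * (l m - l n).
  elim: n => [|n IH]; first by rewrite leqn0 => /eqP ->; rewrite !subrr mulr0 normr0.
  rewrite leq_eqVlt ltnS => /predU1P[->|/IH mn]; first by rewrite !subrr mulr0 normr0.
  by have := ler_distD (U n x) (U n.+1 x) (U m x); have := Ul n x; lra.
have l_cvg : cvgn l.
  apply: nonincreasing_is_cvgn; first exact/nonincreasing_seqP.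
  by exists C => _ [m _ <-].
have Ux_cvg x : cvgn (U ^~ x : R^nat).
  (* Subtracting the multiple of [l n] turns the bound on increments into monotonicity. *)
  suff b_cvg : cvgn (fun n => U n x - `|x| * l n : R).
    have -> : (U ^~ x : R^nat) = (fun n => U n x - `|x| * l n) \+ (fun n => `|x| * l n).
      by apply/funext => n /=; rewrite subrK.
    by apply: is_cvgD => //; apply: cvgP; exact: cvgMl_tmp l_cvg.
  apply: nondecreasing_is_cvgn => [m n mn|].
    by have := Umn _ _ x mn; rewrite ler_norml; lra.
  exists (U 0%N x + `|x| * l 0%N - 2 * `|x| * C) => _ [n _ <-].
  have := Umn _ _ x (leq0n n); rewrite ler_norml.
  by have := ler_wpM2l (normr_ge0 x) (Cl n); lra.
pose u x : R^o := limn (U ^~ x : R^nat).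
have u_lin : linear u.
  move=> k x y; apply: cvg_lim => //.
  have -> : (U ^~ (k *: x + y) : R^nat) = (fun n => k * U n x) \+ U ^~ y.
    by apply/funext => n /=; rewrite linearP.
  by apply: cvgD; [apply: cvgM; [exact: cvg_cst|exact: Ux_cvg]|exact: Ux_cvg].
have uU m x : `|u x - U m x| <= `|x| * (l m - limn l).
  apply: (@ler_cvg_to nat \oo _ R (fun n => `|U n x - U m x|)
    (fun n => `|x| * (l m - l n))).
  - have UB : (fun n => U n x - U m x : R) @ \oo --> (u x - U m x : R).
      by apply: cvgB; [exact: Ux_cvg|exact: cvg_cst].
    exact: cvg_norm UB.
  - by apply: cvgM; [exact: cvg_cst|apply: cvgB => //; exact: cvg_cst].
  - by exists m => // n /= mn; exact: Umn.
have [v vu] : exists v : dual X, forall x, v x = u x.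
  apply: (@dual_of_bounded _ _ _ (dual_norm (U 0%N) + (l 0%N - limn l))) => // x.
  have := dual_norm_ub (U 0%N) x; have := uU 0%N x.
  by have := ler_distD (U 0%N x) (u x) 0; rewrite !subr0; lra.
exists v; split=> [x|z]; first by rewrite vu; exact: Ux_cvg.
apply/cvgrPdist_le => e e0.
have K0 : 0 < dual_norm z + 1 by rewrite ltr_pwDr// dual_norm_ge0.
have : \forall m \near \oo, `|limn l - l m| <= e / (dual_norm z + 1).
  by move/cvgrPdist_le : l_cvg; apply; exact: divr_gt0.
apply: filterS => m lm; rewrite /= -linearB.
apply: le_trans (dual_norm_ub z _) _.
have vUm : `|v - U m| <= `|limn l - l m|.
  apply: dual_norm_le => x x1; rewrite -[(v - U m) x]/(v x - U m x) vu.
  apply: le_trans (uU m x) _; rewrite distrC.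
  apply: le_trans (ler_wpM2l (normr_ge0 x) (ler_norm _)) _.
  by rewrite ler_piMl.
have zK : dual_norm z <= dual_norm z + 1 by rewrite lerDl.
apply: le_trans (ler_pM (dual_norm_ge0 z) (normr_ge0 _) zK (le_trans vUm lm)) _.
by rewrite mulrC divfK// gt_eqF.
Qed.

Lemma convex_epi (R : realType) (E : lmodType R) (h : E -> \bar R) :
  convex_efun h -> convex_rel (fun x r => (h x <= r%:E)%E).
Proof.
move=> hc x y r s t /[dup] t01 /andP[t0 t1] hx hy.
apply: le_trans (hc x y t t01) _.
have t1' : 0 <= 1 - t by rewrite subr_ge0.
by rewrite [leRHS]EFinD; apply: leeD;
  [exact: (lee_wpmul2l _ hx)|exact: (lee_wpmul2l _ hy)].
Qed.

(** This is a subgradient at [xb]: [h] is sandwiched against the single point [xb], with [v] equal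
    to the value of [h] there. *)
Lemma affine_minorant (R : realType) (X : normedModType R) (h : X -> \bar R)
    (xb : X) (rho M : R) :
  convex_efun h -> 0 < rho ->
  (forall x, `|x - xb| < rho -> (h x <= M%:E)%E) -> (-oo < h xb)%E ->
  exists (w : dual X) (b : R), forall x r, (h x <= r%:E)%E -> w x + b <= r.
Proof.
move=> hc rho0 hM hxb.
have [||||||w [b [wb _]]] := @sandwich _ X (fun x r => x = xb /\ r = 0)
  (fun x r => (h x <= r%:E)%E) xb rho 0 M (fine (h xb)).
- move=> x y r s t _ [-> ->] [-> ->]; rewrite -scalerDl subrKC scale1r.
  by rewrite !mulr0 addr0.
- exact: convex_epi.
- by split.
- exact: rho0.
- exact: hM.
- move=> x r s [-> ->] hs; rewrite add0r -lee_fin fineK//.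
  by rewrite fin_numE gt_eqF//= lt_eqF// (le_lt_trans hs)// ltry.
- by exists w, b.
Qed.

(** For [l > 0] one divides by [l]. For [l = 0] the affine function is only known to be nonpositive
    on the domain of [h], and finiteness of the biconjugate at [z] takes over. *)
Lemma biconjugate_epi_affine (R : realType) (X : normedModType R)
    (h : X -> \bar R) (xb : X) (rho M l a : R) (u : dual X) (z : bidual X) :
  convex_efun h -> 0 < rho ->
  (forall x, `|x - xb| < rho -> (h x <= M%:E)%E) -> (-oo < h xb)%E ->
  0 <= l -> (forall x r, (h x <= r%:E)%E -> u x + a <= l * r) ->
  (biconjugate h z <= 0)%E -> z u + a <= 0.
Proof.
move=> hc rho0 hM hxb; rewrite le_eqVlt => /predU1P[<- uh hz|l0 uh hz].
  have [w [b wb]] := affine_minorant hc rho0 hM hxb.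
  apply: (biconjugate_dom_affine wb _ (le_lt_trans hz (ltry _))) => x hx.
  have [r hr] : exists r : R, (h x <= r%:E)%E.
    case: (h x) hx => [r _|//|_]; first by exists r.
    by exists 0; rewrite leNye.
  by have := uh _ _ hr; rewrite mul0r.
exact: biconjugate_le0_affine l0 uh hz.
Qed.

Lemma dual_bounded_above (R : realType) (X : normedModType R) (u : dual X)
    (c : R) :
  (forall x, u x <= c) -> u = 0.
Proof.
move=> uc; apply: val_inj; apply/funext => x /=; apply/eqP/negPn/negP => ux0.
have := uc (((c + 1) / u x) *: x); rewrite linearZ /= /GRing.scale /= divfK//.
lra.
Qed.

Lemma dual_combination (R : realType) (X : normedModType R) (u : dual X)
    (k l : R) (x y : X) :
  u (k *: x + l *: y) = k * u x + l * u y.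
Proof. by rewrite linearD !linearZ. Qed.

(** * The multiplier sequence *)

Section Core.
Variables (R : realType) (X : normedModType R).
Variables (f0 : X -> \bar R) (F : nat -> X -> \bar R).
Variables (xb : X) (rho d c v : R).
Hypotheses (f0_convex : convex_efun f0) (F_convex : forall k, convex_efun (F k)).
Hypotheses (rho_gt0 : 0 < rho) (d_gt0 : 0 < d).
Hypothesis f0_xb : (f0 xb <= c%:E)%E.
Hypothesis F_ball : forall k x, `|x - xb| < rho -> (F k x <= (- d)%:E)%E.
Hypothesis le_v : forall x r,
  (forall k, (F k x <= 0)%E) -> (f0 x <= r%:E)%E -> v <= r.

Let xb_ball : `|xb - xb| < rho. Proof. by rewrite subrr normr0. Qed.

Let F_xb k : (F k xb <= (- d)%:E)%E. Proof. exact: F_ball. Qed.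

(** Pairs of objective gap and common constraint bound avoid the open negative quadrant, so a line
    separates them. The Slater point [xb] excludes zero weight on the objective, which can then be
    normalised to 1. *)
Lemma lagrange_multiplier : exists2 s : R, 0 <= s &
  forall x r q, (f0 x <= r%:E)%E -> (forall k, (F k x <= q%:E)%E) ->
    v <= r + s * q.
Proof.
pose G (p : R^o) q := exists x r,
  [/\ p = r - v, (f0 x <= r%:E)%E & forall k, (F k x <= q%:E)%E].
have [||t /andP[t0 t1] tG] := @plane_separation R G.
- move=> p p' q q' t t01 [x [r [-> fx Fx]]] [x' [r' [-> fx' Fx']]].
  exists (t *: x + (1 - t) *: x'), (t * r + (1 - t) * r'); split.
  + by rewrite /GRing.scale /=; lra.
  + exact: convex_epi.
  + by move=> k; exact: convex_epi.
- move=> p q [x [r [-> fx Fx]]]; have [q0|q0] := leP 0 q; first by right.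
  left; rewrite subr_ge0; apply: le_v fx => k; apply: le_trans (Fx k) _.
  by rewrite lee_fin ltW.
have t_lt1 : t < 1.
  rewrite lt_neqAle t1 andbT; apply/eqP => t_eq.
  have := tG (c - v) (- d); rewrite t_eq => /(_ _).
  have GG : G (c - v) (- d) by exists xb, c.
  by move=> /(_ GG); have := d_gt0; lra.
exists (t / (1 - t)); first by rewrite divr_ge0// subr_ge0.
move=> x r q fx Fx; have := tG (r - v) q.
have GG : G (r - v) q by exists x, r.
move=> /(_ GG) H.
have t1' : 0 < 1 - t by rewrite subr_gt0.
rewrite -lerBlDl mulrAC ler_pdivlMr//; lra.
Qed.

(** The triple holds the slope and constant of [A_m] and the weight [s_m]; [q] stands for any real
    upper bound of [g_m] at [x]. *)
Definition partial_multiplier (m : nat) (st : dual X * R * R) : Prop :=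
  0 <= st.2 /\ forall x r q, (f0 x <= r%:E)%E ->
    (forall k, (m <= k)%N -> (F k x <= q%:E)%E) ->
    v <= r + (st.1.1 x + st.1.2) + st.2 * q.

(** Lying below a nonnegative multiple of [F m] is what makes the increment of the affine part
    nonpositive both on the ball and at [z]. *)
Definition multiplier_step (m : nat) (st st' : dual X * R * R) : Prop :=
  st'.2 <= st.2 /\ exists2 l : R, 0 <= l &
    forall x r, (F m x <= r%:E)%E ->
      (st'.1.1 x + st'.1.2) - (st.1.1 x + st.1.2) <= l * r.

Lemma partial_multiplier_step m st : partial_multiplier m st ->
  exists st', partial_multiplier m.+1 st' /\ multiplier_step m st st'.
Proof.
case: st => [[u a] s] [/= s0 st].
(* The coordinates put the whole weight [s] on [F m] or on the later tail. The larger of [r1] and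
   [r2] bounds the full tail, so one coordinate is nonnegative. *)
pose G (p : R^o) q := exists x r r1 r2,
  [/\ (f0 x <= r%:E)%E, (F m x <= r1%:E)%E,
      forall k, (m < k)%N -> (F k x <= r2%:E)%E,
      p = r + (u x + a) + s * r1 - v & q = r + (u x + a) + s * r2 - v].
have [||t /andP[t0 t1] tG] := @plane_separation R G.
- move=> p p' q q' t t01 [x [r [r1 [r2 [fx Fx1 Fx2 -> ->]]]]].
  move=> [x' [r' [r1' [r2' [fx' Fx1' Fx2' -> ->]]]]].
  exists (t *: x + (1 - t) *: x'), (t * r + (1 - t) * r').
  exists (t * r1 + (1 - t) * r1'), (t * r2 + (1 - t) * r2'); split.
  + exact: convex_epi.
  + exact: convex_epi.
  + by move=> k mk; apply: convex_epi => //; [exact: Fx2|exact: Fx2'].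
  + by rewrite dual_combination /GRing.scale /=; lra.
  + by rewrite dual_combination /GRing.scale /=; lra.
- move=> p q [x [r [r1 [r2 [fx Fx1 Fx2 -> ->]]]]]; rewrite !subr_ge0.
  have [r12|r21] := leP r1 r2; [right|left]; apply: st => // k.
    rewrite leq_eqVlt => /predU1P[<-|/Fx2//].
    by apply: le_trans Fx1 _; rewrite lee_fin.
  rewrite leq_eqVlt => /predU1P[<-//|/Fx2 Fk].
  by apply: le_trans Fk _; rewrite lee_fin ltW.
have lG x r r1 r2 : (f0 x <= r%:E)%E -> (F m x <= r1%:E)%E ->
    (forall k, (m < k)%N -> (F k x <= r2%:E)%E) ->
    v <= (r + (u x + a) + (s * t) * r2) + (s * (1 - t)) * r1.
  move=> fx Fx1 Fx2.
  have := tG (r + (u x + a) + s * r1 - v) (r + (u x + a) + s * r2 - v).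
  have GG : G (r + (u x + a) + s * r1 - v) (r + (u x + a) + s * r2 - v).
    by exists x, r, r1, r2.
  by move=> /(_ GG); lra.
(* The share [s * (1 - t)] of [F m], bounded above on the ball, is replaced by an affine minorant;
   everything else goes into the first relation. *)
have [||||||w [b [w2 w1]]] := @sandwich _ X
  (fun x y => exists r r2, [/\ (f0 x <= r%:E)%E,
     forall k, (m < k)%N -> (F k x <= r2%:E)%E &
     y = r + (u x + a) + (s * t) * r2])
  (fun x y => exists2 r1, (F m x <= r1%:E)%E & y = (s * (1 - t)) * r1)
  xb rho (c + (u xb + a) + (s * t) * (- d)) ((s * (1 - t)) * (- d)) v.
- move=> x x' y y' k k01 [r [r2 [fx Fx ->]]] [r' [r2' [fx' Fx' ->]]].
  exists (k * r + (1 - k) * r'), (k * r2 + (1 - k) * r2'); split.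
  + exact: convex_epi.
  + by move=> n mn; apply: convex_epi => //; [exact: Fx|exact: Fx'].
  + by rewrite dual_combination /GRing.scale /=; lra.
- move=> x x' y y' k k01 [r1 Fx ->] [r1' Fx' ->].
  by exists (k * r1 + (1 - k) * r1'); [exact: convex_epi|lra].
- by exists c, (- d).
- exact: rho_gt0.
- by move=> x xB; exists (- d) => //; exact: F_ball.
- move=> x y y' [r [r2 [fx Fx ->]]] [r1 Fx1 ->]; exact: lG.
exists (u + w, a + b, s * t); split; split.
- exact: mulr_ge0.
- move=> x r q fx Fx.
  change (v <= r + ((u x + w x) + (a + b)) + s * t * q).
  suff : v <= (r + (u x + a) + s * t * q) + (w x + b) by lra.
  by apply: w1; exists r, q.
- exact: ler_piMr.
- exists (s * (1 - t)); first by rewrite mulr_ge0// subr_ge0.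
  move=> x r Fx; change ((u x + w x + (a + b)) - (u x + a) <= s * (1 - t) * r).
  suff : w x + b <= s * (1 - t) * r by lra.
  by apply: w2; exists r.
Qed.

(** The epigraph of the upper limit of the [F k], written with real bounds only. *)
Definition limsup_le (x : X) (q : R) : Prop :=
  forall e, 0 < e -> exists m, forall k, (m <= k)%N -> (F k x <= (q + e)%:E)%E.

(** The condition on [z] abstracts nonpositivity of the biconjugates of all [F k]. It gives
    [z (U m) + A m <= 0] by induction, and norm convergence of [U] preserves this. *)
Lemma limit_multiplier : exists (u : dual X) (a s : R),
  [/\ 0 <= s,
      forall x r q, (f0 x <= r%:E)%E -> limsup_le x q ->
        v <= r + (u x + a) + s * q &
      forall z : bidual X,
        (forall k (w : dual X) b l, 0 <= l ->
          (forall x r, (F k x <= r%:E)%E -> w x + b <= l * r) -> z w + b <= 0) ->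
        z u + a <= 0].
Proof.
have [s0 s00 s0P] := lagrange_multiplier.
have next (p : nat * (dual X * R * R)) : exists st', partial_multiplier p.1 p.2 ->
    partial_multiplier p.1.+1 st' /\ multiplier_step p.1 p.2 st'.
  have [/partial_multiplier_step[st' H]|nP] := pselect (partial_multiplier p.1 p.2).
    by exists st'.
  by exists p.2.
have [g gP] := choice next.
pose st := nat_rect (fun=> dual X * R * R)%type (0, 0, s0) (fun m s => g (m, s)).
have stP m : partial_multiplier m (st m).
  elim: m => [|m IH]; last by have [] := gP (m, st m) IH.
  split=> // x r q fx Fx /=; rewrite [(0 : X -> R^o) x]/(0 : R) !addr0.
  by apply: s0P fx _ => k; exact: Fx.
have stS m : multiplier_step m (st m) (st m.+1).
  by have [] := gP (m, st m) (stP m).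
pose U m := (st m).1.1; pose A m := (st m).1.2; pose S m := (st m).2.
have SP m : 0 <= S m := (stP m).1.
have lS m : S m.+1 <= S m := (stS m).1.
have U_dec m x : `|x - xb| < rho -> U m.+1 x + A m.+1 <= U m x + A m.
  move=> xB; have [_ [l l0 lP]] := stS m.
  rewrite -subr_le0; apply: le_trans (lP x (- d) (F_ball _ xB)) _.
  by rewrite mulrN oppr_le0 mulr_ge0// ltW.
(* An affine increment that is nonpositive on the ball has slope at most its drop at the centre
   divided by [rho / 2], so the decrease of [L] controls the increments of [U]. *)
pose L m := (rho / 2)^-1 * (U m xb + A m).
have rho20 : 0 < (rho / 2)^-1 by rewrite invr_gt0 divr_gt0.
have L_dec m : L m.+1 <= L m by rewrite ler_pM2l// U_dec.
(* The partial multiplier inequality at [xb] with [q = - d] bounds the affine part there from below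
   by [v - c]. *)
have L_ge m : (rho / 2)^-1 * (v - c) <= L m.
  rewrite ler_pM2l//; have := (stP m).2 xb c (- d) f0_xb (fun k _ => F_xb k).
  rewrite -/(U m) -/(A m) -/(S m).
  by have := mulr_ge0 (SP m) (ltW d_gt0); lra.
have UL m x : `|U m.+1 x - U m x| <= `|x| * (L m - L m.+1).
  have [->|x0] := eqVneq x 0.
    by rewrite (linear0 (U m)) (linear0 (U m.+1)) subr0 !normr0 mul0r.
  have nx : 0 < `|x| by rewrite normr_gt0.
  pose t := rho / 2 / `|x|.
  have t0 : 0 < t by rewrite !divr_gt0.
  have t_lt : t * `|x| < rho.
    by rewrite divfK ?gt_eqF// ltr_pdivrMr// ltr_pMr// ltr1n.
  have := U_dec m (xb + t *: x).
  rewrite addrC addKr normrZ gtr0_norm// => /(_ t_lt) Hp.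
  have := U_dec m (xb + - t *: x).
  rewrite addrC addKr normrZ normrN gtr0_norm// => /(_ t_lt) Hm.
  rewrite -(ler_pM2l t0).
  have -> : t * (`|x| * (L m - L m.+1)) = U m xb + A m - (U m.+1 xb + A m.+1).
    by rewrite mulrA divfK ?gt_eqF// /L -mulrBr mulrA divff ?mul1r// gt_eqF// divr_gt0.
  rewrite -[X in X * _]gtr0_norm// -normrM ler_norml.
  have U_line n k : U n (xb + k *: x) = U n xb + k * U n x.
    by rewrite linearD linearZ.
  move: Hp Hm; rewrite !U_line.
  by move=> Hp Hm; apply/andP; split; lra.
have [u [uP zP]] := dual_limit UL L_dec L_ge.
have L_cvg : cvgn L.
  apply: nonincreasing_is_cvgn; first exact/nonincreasing_seqP.
  by exists ((rho / 2)^-1 * (v - c)) => _ [m _ <-].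
have S_cvg : cvgn S.
  apply: nonincreasing_is_cvgn; first exact/nonincreasing_seqP.
  by exists 0 => _ [m _ <-].
pose a := rho / 2 * limn L - u xb.
have A_cvg : A @ \oo --> a.
  have -> : A = (fun m => rho / 2 * L m - U m xb).
    apply/funext => m; rewrite /L mulrA divff ?mul1r; last first.
      by rewrite gt_eqF// divr_gt0.
    by lra.
  by apply: cvgB; [exact: cvgMl_tmp L_cvg|exact: uP].
exists u, a, (limn S); split.
- by apply: limr_ge => //; exists 0%N => // m _; exact: SP.
- move=> x r q fx qx.
  have H e : 0 < e -> v <= r + (u x + a) + limn S * (q + e).
    move=> /qx[m mq].
    have cvg : (fun n => r + (U n x + A n) + S n * (q + e)) @ \oo -->
        r + (u x + a) + limn S * (q + e).
      apply: cvgD; last exact: cvgMr_tmp S_cvg.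
      by apply: cvgD; [exact: cvg_cst|apply: cvgD => //; exact: uP].
    apply: (cvgr_to_ge cvg); exists m => // n /= mn.
    apply: (stP n).2 => // k nk; apply: mq; exact: leq_trans nk.
  have lim0 : 0 <= limn S.
    by apply: limr_ge => //; exists 0%N => // m _; exact: SP.
  apply/ler_addgt0Pr => e e0.
  have S1 : 0 < limn S + 1 by rewrite ltr_wpDl.
  have := H (e / (limn S + 1)) (divr_gt0 e0 S1).
  have : limn S * (e / (limn S + 1)) <= e.
    rewrite mulrCA; apply: ler_piMr; first exact: ltW.
    by rewrite ler_pdivrMr// mul1r lerDl.
  by lra.
- move=> z zF; have zU m : z (U m) + A m <= 0.
    elim: m => [|m IH]; first by rewrite /U /A /= linear0 addr0.
    have [_ [l l0 lP]] := stS m.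
    have := zF m (U m.+1 - U m) (A m.+1 - A m) l l0.
    rewrite linearB => H; suff: z (U m.+1) - z (U m) + (A m.+1 - A m) <= 0 by lra.
    apply: H => x r /lP; rewrite -/(U m) -/(U m.+1) -/(A m) -/(A m.+1) => H.
    by change ((U m.+1 x - U m x) + (A m.+1 - A m) <= l * r); lra.
  have cvg : (fun m => z (U m) + A m) @ \oo --> z u + a.
    by apply: cvgD => //; exact: zP.
  by apply: (cvgr_to_le cvg); exists 0%N => // m _; exact: zU.
Qed.

(** * Lower bounds on the biconjugate of the objective *)

Lemma lower_bound_on (E : set X) (u : dual X) (a : R) (z : bidual X) :
  (forall x y t, 0 <= t <= 1 -> E x -> E y -> E (t *: x + (1 - t) *: y)) ->
  (forall x, `|x - xb| < rho -> E x) ->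
  (forall x r, (f0 x <= r%:E)%E -> E x -> v <= r + (u x + a)) ->
  z u + a <= 0 ->
  (forall (w : dual X) b, (forall x, E x -> w x + b <= 0) -> z w + b <= 0) ->
  (v%:E <= biconjugate f0 z)%E.
Proof.
move=> E_convex E_ball uE zu zE.
(* The second relation is the epigraph of the indicator function of [E]. *)
have [||||||w [b [w2 w1]]] := @sandwich _ X
  (fun x y => exists2 r, (f0 x <= r%:E)%E & y = r + (u x + a))
  (fun x y => E x /\ 0 <= y) xb rho (c + (u xb + a)) 0 v.
- move=> x x' y y' k k01 [r fx ->] [r' fx' ->].
  exists (k * r + (1 - k) * r'); first exact: convex_epi.
  by rewrite dual_combination; lra.
- move=> x x' y y' k /[dup] k01 /andP[k0 k1] [Ex y0] [Ex' y'0]; split.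
    exact: E_convex.
  by rewrite addr_ge0// mulr_ge0// subr_ge0.
- by exists c.
- exact: rho_gt0.
- by move=> x xB; split=> //; exact: E_ball.
- by move=> x y y' [r fx ->] [Ex y'0]; have := uE _ _ fx Ex; lra.
have zw : z w + b <= 0 by apply: zE => x Ex; exact: w2.
(* At [z] this minorant of [f0] equals [v] minus the nonpositive numbers [z u + a] and [z w + b]. *)
apply: le_trans (@biconjugate_ge _ _ f0 (- (u + w)) (v - a - b) z _).
  by rewrite lee_fin linearN linearD; lra.
move=> x r fx; have : v <= r + (u x + a) + (w x + b) by apply: w1; exists r.
by change (v <= r + (u x + a) + (w x + b) -> - (u x + w x) + (v - a - b) <= r); lra.
Qed.

Section Bound.
Variables (E : set X) (z : bidual X).
Hypothesis E_convex :
  forall x y t, 0 <= t <= 1 -> E x -> E y -> E (t *: x + (1 - t) *: y).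
Hypothesis E_ball : forall x, `|x - xb| < rho -> E x.
Hypothesis zF : forall k (w : dual X) b l, 0 <= l ->
  (forall x r, (F k x <= r%:E)%E -> w x + b <= l * r) -> z w + b <= 0.
Hypothesis zE :
  forall (w : dual X) b, (forall x, E x -> w x + b <= 0) -> z w + b <= 0.

Lemma lower_bound_limsup_le0 :
  (forall x, E x -> limsup_le x 0) -> (v%:E <= biconjugate f0 z)%E.
Proof.
move=> E0; have [u [a [s [s0 uP zu]]]] := limit_multiplier.
apply: (@lower_bound_on E u a) => //; last exact: zu.
by move=> x r fx /E0 x0; have := uP x r 0 fx x0; rewrite mulr0 addr0.
Qed.

(** The hypothesis on [z] covers only [l > 0]: the upper limit may be -oo and then has no affine
    minorant with which to treat [l = 0]. Hence the separate case [s = 0], where any real [q] will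
    do. *)
Lemma lower_bound_limsup_bidual :
  (forall x, E x -> exists q, limsup_le x q) ->
  (forall (w : dual X) b l, 0 < l ->
    (forall x q, limsup_le x q -> w x + b <= l * q) -> z w + b <= 0) ->
  (v%:E <= biconjugate f0 z)%E.
Proof.
move=> Eq zq; have [u [a [s [s0 uP /(_ z zF) zu]]]] := limit_multiplier.
have [s_eq0|s_neq0] := eqVneq s 0.
  apply: (@lower_bound_on E u a) => // x r fx /Eq[q xq].
  by have := uP x r q fx xq; rewrite s_eq0 mul0r addr0.
have s_gt0 : 0 < s by rewrite lt_neqAle eq_sym s_neq0.
have [||||||w [b [w2 w1]]] := @sandwich _ X
  (fun x y => E x /\ exists2 r, (f0 x <= r%:E)%E & y = r + (u x + a))
  (fun x y => exists2 q, limsup_le x q & y = s * q) xb rho (c + (u xb + a))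
  (s * (- d)) v.
- move=> x x' y y' k k01 [Ex [r fx ->]] [Ex' [r' fx' ->]]; split.
    exact: E_convex.
  exists (k * r + (1 - k) * r'); first exact: convex_epi.
  by rewrite dual_combination; lra.
- move=> x x' y y' k k01 [q xq ->] [q' xq' ->].
  exists (k * q + (1 - k) * q'); last by lra.
  move=> e e0; have [m mq] := xq e e0; have [m' mq'] := xq' e e0.
  exists (maxn m m') => n; rewrite geq_max => /andP[mn m'n].
  rewrite (_ : _ + e = k * (q + e) + (1 - k) * (q' + e)); last by ring.
  by apply: convex_epi => //; [exact: mq|exact: mq'].
- split; last by exists c.
  exact: E_ball.
- exact: rho_gt0.
- move=> x xB; exists (- d) => // e e0; exists 0%N => k _.
  by apply: le_trans (F_ball k xB) _; rewrite lee_fin lerDl ltW.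
- by move=> x y y' [Ex [r fx ->]] [q xq ->]; exact: uP.
apply: (@lower_bound_on E (u + w) (a + b)) => //.
  move=> x r fx Ex; have : v <= r + (u x + a) + (w x + b).
    by apply: w1; split=> //; exists r.
  by change (v <= r + (u x + a) + (w x + b) -> v <= r + (u x + w x + (a + b))); lra.
have : z w + b <= 0 by apply: (zq w b s) => // x q xq; apply: w2; exists q.
by rewrite linearD; lra.
Qed.

End Bound.

End Core.

(** * Reduction of the problem to a sequence of constraints *)

Lemma constraint1 (N : option nat) (k : nat) : constraint N k -> constraint N 1.
Proof. by case: N => //= n /andP[k0]; exact: leq_trans. Qed.

Lemma lty_real_ub (R : realType) (y : \bar R) :
  (y < +oo)%E -> exists r : R, (y <= r%:E)%E.
Proof.
by case: y => [r _|//|_]; [exists r|exists 0; rewrite leNye].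
Qed.

Lemma limn_esup_lt (R : realType) (u : (\bar R)^nat) (y : \bar R) :
  (limn_esup u < y)%E ->
  exists2 q, (q < y)%E & exists m, forall k, (m <= k)%N -> (u k <= q)%E.
Proof.
move=> /ereal_inf_ltP[_ [V [m _ mV] <-] Vy].
exists (ereal_sup (u @` V)) => //.
by exists m => k mk; apply: ereal_sup_ubound; exists k => //; exact: mV.
Qed.

Lemma limn_esup_le_bound (R : realType) (u : (\bar R)^nat) (m : nat)
    (y : \bar R) :
  (forall k, (m <= k)%N -> (u k <= y)%E) -> (limn_esup u <= y)%E.
Proof.
move=> uy; apply: (@le_trans _ _ (ereal_sup (u @` [set k | (m <= k)%N]))).
  by apply: ereal_inf_lbound; exists [set k | (m <= k)%N] => //; exists m.
by apply: ge_ereal_sup => _ [k mk <-]; exact: uy.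
Qed.

Section Constraints.
Variables (R : realType) (X : normedModType R) (N : option nat).
Variables (f0 : X -> \bar R) (f : nat -> X -> \bar R).
Hypothesis f0_convex : convex_efun f0.
Hypothesis f_convex : forall k, constraint N k -> convex_efun (f k).
Local Open Scope ereal_scope.

Lemma sup_fun_leP (x : X) (y : \bar R) :
  sup_fun N f x <= y <-> forall k, constraint N k -> f k x <= y.
Proof.
split=> [fx k Nk|fx]; last by apply: ge_ereal_sup => _ [k Nk <-]; exact: fx.
by apply: le_trans fx; apply: ereal_sup_ubound; exists k.
Qed.

Lemma sup_fun_convex (x y : X) (t : R) : (0 <= t <= 1)%R ->
  edom (sup_fun N f) x -> edom (sup_fun N f) y ->
  edom (sup_fun N f) (t *: x + (1 - t) *: y)%R.
Proof.
move=> t01 /lty_real_ub[r /sup_fun_leP fx] /lty_real_ub[s /sup_fun_leP fy].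
apply: (@le_lt_trans _ _ (t * r + (1 - t) * s)%:E); last exact: ltry.
apply/sup_fun_leP => k Nk.
by apply: convex_epi => //; [exact: f_convex|exact: fx|exact: fy].
Qed.

(** A small step from the Slater point [x0] towards the continuity point [x1] keeps the constraints
    negative, and carries a shrunken copy of the ball around [x1] on which they are bounded. *)
Lemma slater_ball :
  (exists x0 : X, edom f0 x0 /\ sup_fun N f x0 < 0) ->
  (exists x1 : X, [/\ edom f0 x1,
     sup_fun N f x1 \is a fin_num & {for x1, continuous (sup_fun N f)}]) ->
  exists (xb : X) (rho d c : R), [/\ (0 < rho)%R, (0 < d)%R, f0 xb <= c%:E &
    forall k x, constraint N k -> (`|x - xb| < rho)%R -> f k x <= (- d)%:E].
Proof.
move=> [x0 [/lty_real_ub[c0 fc0] fx0]] [x1 [/lty_real_ub[c1 fc1] fin1 cont1]].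
have [d0 d00 /sup_fun_leP fd0] : exists2 d0 : R, (0 < d0)%R & sup_fun N f x0 <= (- d0)%:E.
  case: (sup_fun N f x0) fx0 => [r| |] //.
    by rewrite lte_fin => r0; exists (- r)%R; rewrite ?oppr_gt0 ?opprK.
  by exists 1%R; rewrite ?leNye.
pose M := (`|fine (sup_fun N f x1)| + 1)%R.
have M0 : (0 < M)%R by rewrite ltr_wpDl.
have [r r0 fM] : exists2 r : R, (0 < r)%R & forall x, (`|x - x1| < r)%R ->
    sup_fun N f x <= M%:E.
  have : nbhs (sup_fun N f x1) [set y | y < M%:E].
    apply: open_nbhs_nbhs; split; first exact: open_ereal_lt_ereal.
    by rewrite /= -(fineK fin1) lte_fin ltr_pwDr// ler_norm.
  move=> /cont1 /nbhs_normP[r /= r0 rM]; exists r => // x xr.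
  by apply/ltW/rM; rewrite /ball_ /= distrC.
(* Chosen so that [t * M - (1 - t) * d0 = - (d0 / 2)]. *)
pose t := (d0 / (2 * (M + d0)))%R.
have Md : (0 < M + d0)%R by exact: addr_gt0.
have t0 : (0 < t)%R by rewrite divr_gt0// mulr_gt0.
have t1 : (t <= 1)%R by rewrite ler_pdivrMr ?mulr_gt0//; lra.
have tMd : (t * (M + d0) = d0 / 2)%R by rewrite /t; field; rewrite gt_eqF.
have t01 : (0 <= t <= 1)%R by rewrite ltW.
exists (t *: x1 + (1 - t) *: x0)%R, (t * r)%R, (d0 / 2)%R, (t * c1 + (1 - t) * c0)%R.
split; [exact: mulr_gt0|exact: divr_gt0|exact: convex_epi|].
move=> k x Nk xr.
pose y := (t^-1 *: (x - (1 - t) *: x0))%R.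
have yr : (`|y - x1| < r)%R.
  rewrite -(ltr_pM2l t0) -{1}(gtr0_norm t0) -normrZ scalerBr.
  by rewrite /y scalerA divff ?gt_eqF// scale1r -addrA -opprD (addrC (_ *: x0)%R).
have -> : x = (t *: y + (1 - t) *: x0)%R.
  by rewrite /y scalerA divff ?gt_eqF// scale1r subrK.
have fky : f k y <= M%:E by apply: (sup_fun_leP _ _).1 => //; exact: fM.
apply: le_trans (convex_epi (f_convex Nk) t01 fky (fd0 k Nk)) _.
by rewrite lee_fin; lra.
Qed.

(** * Domain of the sum of positive parts *)

Let partial m x := \sum_(1 <= k < m.+1 | constraint N k) (f k)^\+ x.

Let partial_mono m n x : (m <= n)%N -> partial m x <= partial n x.
Proof. by move=> mn; apply: lee_sum_nneg_natr. Qed.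

Lemma sum_fun_domP (x : X) : edom (sum_fun N (fun k => (f k)^\+)) x <->
  exists M : R, forall m, partial m x <= M%:E.
Proof.
split=> [/limn_esup_lt[q q_lt [m mq]]|[M Mx]]; last first.
  apply: (@le_lt_trans _ _ M%:E); last exact: ltry.
  by apply: (@limn_esup_le_bound _ _ 0%N) => m _; exact: Mx.
have [M qM] := lty_real_ub q_lt; exists M => n.
apply: le_trans (partial_mono x (leq_maxl n m)) _.
by apply: le_trans (mq _ (leq_maxr n m)) qM.
Qed.

Lemma sum_fun_convex (x y : X) (t : R) : (0 <= t <= 1)%R ->
  edom (sum_fun N (fun k => (f k)^\+)) x ->
  edom (sum_fun N (fun k => (f k)^\+)) y ->
  edom (sum_fun N (fun k => (f k)^\+)) (t *: x + (1 - t) *: y)%R.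
Proof.
move=> /[dup] t01 /andP[t0 t1] /sum_fun_domP[M Mx] /sum_fun_domP[M' My].
have t1' : (0 <= 1 - t)%R by rewrite subr_ge0.
apply/sum_fun_domP; exists (t * M + (1 - t) * M')%R => m.
apply: (@le_trans _ _ (t%:E * partial m x + (1 - t)%:E * partial m y)).
  rewrite /partial !ge0_sume_distrr// -big_split /=.
  apply: lee_sum => k Nk; rewrite !funeposE ge_max; apply/andP; split.
    apply: le_trans (f_convex Nk _ _ t01) _.
    by apply: leeD; apply: lee_wpmul2l => //; rewrite le_max lexx.
  by apply: adde_ge0; apply: mule_ge0; rewrite ?lee_fin// le_max lexx orbT.
by rewrite [leRHS]EFinD; apply: leeD;
  [exact: (lee_wpmul2l _ (Mx m))|exact: (lee_wpmul2l _ (My m))].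
Qed.

(** Once a partial sum is within [e] of the supremum [L], every later term is at most [e]. This
    gives a nonpositive upper limit on the domain of the sum. *)
Lemma sum_fun_cvg0 (x : X) (e : R) : (0 < e)%R ->
  edom (sum_fun N (fun k => (f k)^\+)) x ->
  exists m, forall k, (m <= k)%N -> constraint N k -> f k x <= e%:E.
Proof.
move=> e0 /sum_fun_domP[M Mx].
pose L := ereal_sup [set partial m x | m in setT].
have L_ub m : partial m x <= L by apply: ereal_sup_ubound; exists m.
have L_fin : L \is a fin_num.
  rewrite fin_numE gt_eqF/=; last first.
    by apply: lt_le_trans (L_ub 0%N); rewrite /partial big_geq.
  rewrite lt_eqF//; apply: (@le_lt_trans _ _ M%:E); last exact: ltry.
  by apply: ge_ereal_sup => _ [m _ <-].
have [_ [m _ <-] Lm] := ub_ereal_sup_adherent e0 L_fin.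
exists m.+1 => -[//|k] mk Nk.
have fk : f k.+1 x <= (f k.+1)^\+ x by rewrite funeposE le_max lexx.
apply: le_trans fk _.
have : partial k x + (f k.+1)^\+ x <= L.
  apply: le_trans (L_ub k.+1).
  by rewrite /partial big_mkcond [leRHS]big_mkcond [leRHS]big_nat_recr//= Nk.
have : L - e%:E < partial k x by apply: lt_le_trans Lm (partial_mono _ _).
have : partial k x <= L by [].
have : 0 <= partial k x by rewrite /partial; apply: sume_ge0 => i _; exact: funepos_ge0.
move: L_fin; clear; case: L => // l _; case: (partial k x) => // p _ _.
case: ((f k.+1)^\+ x) => [q| |] //; last by move=> *; rewrite leNye.
by rewrite -EFinB lte_fin -EFinD !lee_fin => lp pq; lra.
Qed.

(** * Upper bounds through the canonical embedding *)

Lemma value_P1_le : value_P1 N f0 f <= value_P N f0 f.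
Proof.
apply: le_ereal_inf_tmp => _ [x fx <-].
apply: le_trans (biconjugate_canonical f0 x).
apply: ereal_inf_lbound; exists (canonical_embedding x) => //; split.
- by move=> k Nk; apply: le_trans (biconjugate_canonical _ _) (fx k Nk).
- apply: le_trans (biconjugate_canonical _ _) _; rewrite /limsup_fun.
  case: N fx => [n _|fx]; first by rewrite leNye.
  (* Index 0 carries no constraint, so the bound starts at 1. *)
  by apply: (@limn_esup_le_bound _ _ 1%N) => k k0; apply: fx; rewrite /constraint k0.
- apply: le_lt_trans (biconjugate_canonical _ _) _.
  by apply: (@le_lt_trans _ _ 0) => //; apply/sup_fun_leP.
Qed.

Lemma value_P2_le : value_P2 N f0 f <= value_P N f0 f.
Proof.
apply: le_ereal_inf_tmp => _ [x fx <-].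
apply: le_trans (biconjugate_canonical f0 x).
apply: ereal_inf_lbound; exists (canonical_embedding x) => //; split.
  by move=> k Nk; apply: le_trans (biconjugate_canonical _ _) (fx k Nk).
apply: (@subset_closure (weak_star (dual X))); exists x => //.
apply/sum_fun_domP; exists 0%R => m; rewrite /partial big1// => k Nk.
by rewrite funeposE; apply/max_idPr; exact: fx.
Qed.

(** * Lower bounds at a feasible point of the bidual *)

Section LowerBound.
Variables (xb : X) (rho d c v : R).
Hypothesis f_proper : forall k, constraint N k -> proper_efun (f k).
Hypotheses (rho_gt0 : (0 < rho)%R) (d_gt0 : (0 < d)%R).
Hypothesis f0_xb : f0 xb <= c%:E.
Hypothesis f_ball : forall k x, constraint N k -> (`|x - xb| < rho)%R ->
  f k x <= (- d)%:E.
Hypothesis value_v : value_P N f0 f = v%:E.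

(* Padding with a negative constant reduces finite families to infinite ones. *)
Let F k : X -> \bar R := if constraint N k.+1 then f k.+1 else cst (- d)%:E.

Let F_convex k : convex_efun (F k).
Proof.
rewrite /F; case: ifP => [|_ x y t _]; first exact: f_convex.
by rewrite /cst -!EFinM -EFinD lee_fin; lra.
Qed.

Let F_ball k x : (`|x - xb| < rho)%R -> F k x <= (- d)%:E.
Proof. by rewrite /F; case: ifP => // Nk; exact: f_ball. Qed.

Let F_le_v x r : (forall k, F k x <= 0) -> f0 x <= r%:E -> (v <= r)%R.
Proof.
move=> Fx fx; rewrite -lee_fin -value_v; apply: le_trans fx.
apply: ereal_inf_lbound; exists x => // -[//|k] Nk.
by have := Fx k; rewrite /F Nk.
Qed.

Section Point.
Variable z : bidual X.
Hypothesis fz : forall k, constraint N k -> biconjugate (f k) z <= 0.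

Let zF k (w : dual X) (b l : R) : (0 <= l)%R ->
  (forall x r, F k x <= r%:E -> (w x + b <= l * r)%R) -> (z w + b <= 0)%R.
Proof.
rewrite /F; case: ifP => [Nk l0 wF|_ l0 wF].
  apply: (biconjugate_epi_affine (f_convex Nk) rho_gt0 _ _ l0 wF (fz Nk)).
    by move=> x; exact: f_ball.
  exact: (f_proper Nk).1.
(* Under a padding constant the affine function is bounded above, hence constant and nonpositive. *)
have wb x : (w x + b <= 0)%R.
  by apply: le_trans (wF x (- d)%R (lexx _)) _; rewrite mulrN oppr_le0 mulr_ge0// ltW.
rewrite (@dual_bounded_above _ _ w (- b)%R) ?linear0 => [|x].
  by have := wb 0%R; rewrite linear0.
by have := wb x; lra.
Qed.

Lemma value_P2_lower : weak_star_closure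
    (@canonical_embedding R X @` edom (sum_fun N (fun k => (f k)^\+))) z ->
  v%:E <= biconjugate f0 z.
Proof.
move=> zE.
apply: (lower_bound_limsup_le0 f0_convex F_convex rho_gt0 d_gt0 f0_xb F_ball
  F_le_v (E := edom (sum_fun N (fun k => (f k)^\+)))).
- by move=> x y t; exact: sum_fun_convex.
- move=> x xB; apply/sum_fun_domP; exists 0%R => m.
  rewrite /partial big1// => k Nk; rewrite funeposE; apply/max_idPr.
  by apply: le_trans (f_ball Nk xB) _; rewrite lee_fin oppr_le0 ltW.
- exact: zF.
- by move=> w b wE; exact: weak_star_closure_affine wE zE.
- move=> x xE e e0; have [m mf] := sum_fun_cvg0 e0 xE; exists m => k mk.
  rewrite add0r /F; case: ifP => Nk; first by apply: mf => //; exact: leqW.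
  by rewrite lee_fin; have := d_gt0; lra.
Qed.

Lemma value_P1_lower : constraint N 1%N ->
  biconjugate (limsup_fun N f) z <= 0 -> edom (biconjugate (sup_fun N f)) z ->
  v%:E <= biconjugate f0 z.
Proof.
move=> N1 zlim zsup.
have E_ball x : (`|x - xb| < rho)%R -> edom (sup_fun N f) x.
  move=> xB; apply: (@le_lt_trans _ _ (- d)%:E); last exact: ltry.
  by apply/sup_fun_leP => k Nk; exact: f_ball.
have zE (w : dual X) b : (forall x, edom (sup_fun N f) x -> w x + b <= 0)%R ->
    (z w + b <= 0)%R.
  (* An affine minorant of [f 1] is also one of the supremum. *)
  move=> wE; have [w1 [b1 wb1]] := affine_minorant (f_convex N1) rho_gt0
    (fun x => f_ball N1) ((f_proper N1).1 xb).
  apply: (biconjugate_dom_affine _ wE zsup) => x r /sup_fun_leP fx.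
  by apply: wb1; exact: fx.
case def_N : N => [n|].
  apply: (lower_bound_limsup_le0 f0_convex F_convex rho_gt0 d_gt0 f0_xb F_ball
    F_le_v sup_fun_convex E_ball zF zE) => x _ e e0.
  (* [F k] is built from [f k.+1], so from [k = n] on only the padding [- d] remains. *)
  exists n => k nk; rewrite /F /constraint def_N /= leqNgt ltnS nk /=.
  by rewrite lee_fin; have := d_gt0; lra.
apply: (lower_bound_limsup_bidual f0_convex F_convex rho_gt0 d_gt0 f0_xb F_ball
  F_le_v sup_fun_convex E_ball zF zE).
  move=> x /lty_real_ub[M /sup_fun_leP fM]; exists M => e e0; exists 0%N => k _.
  rewrite /F; case: ifP => Nk; last by move: Nk; rewrite /constraint def_N.
  by apply: le_trans (fM _ Nk) _; rewrite lee_fin; lra.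
move=> w b l l0 wq; apply: (biconjugate_le0_affine l0 _ zlim) => x r.
rewrite /limsup_fun def_N => xr; apply: wq => e e0.
have [q qr [m mq]] : exists2 q, q < (r + e)%:E &
    exists m, forall k, (m <= k)%N -> f k x <= q.
  by apply: limn_esup_lt; apply: le_lt_trans xr _; rewrite lte_fin; lra.
exists m => k mk; rewrite /F /constraint def_N /=.
by apply: le_trans (mq _ (leqW mk)) (ltW qr).
Qed.

End Point.
End LowerBound.
End Constraints.

(** * Equality of the three values *)

Local Open Scope ereal_scope.

Theorem corollary7 (R : realType) (X : completeNormedModType R)
  (N : option nat) (f0 : X -> \bar R) (f : nat -> X -> \bar R)
  (f0_proper : proper_efun f0) (f0_convex : convex_efun f0)
  (f_proper : forall k, constraint N k -> proper_efun (f k))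
  (f_convex : forall k, constraint N k -> convex_efun (f k))
  (value_lty : value_P N f0 f < +oo)
  (slater : exists x0 : X, edom f0 x0 /\ sup_fun N f x0 < 0)
  (f_continuous : exists x1 : X, [/\ edom f0 x1,
     sup_fun N f x1 \is a fin_num & {for x1, continuous (sup_fun N f)}]) :
  value_P1 N f0 f = value_P2 N f0 f /\ value_P2 N f0 f = value_P N f0 f.
Proof.
have [xb [rho [d [c [rho0 d0 fxb f_ball]]]]] :=
  slater_ball f0_convex f_convex slater f_continuous.
(* Without constraints the supremum would be -oo everywhere, contradicting its finiteness at
   [x1]. *)
have N1 : constraint N 1%N.
  apply/negPn/negP => N1; have [x1 [_ + _]] := f_continuous.
  rewrite /sup_fun (_ : [set k | _] = set0) ?image_set0 ?ereal_sup0//.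
  by apply/seteqP; split=> // k /constraint1; rewrite (negbTE N1).
suff [le1 le2] : value_P N f0 f <= value_P1 N f0 f /\
    value_P N f0 f <= value_P2 N f0 f.
  have -> : value_P1 N f0 f = value_P N f0 f.
    by apply/eqP; rewrite eq_le value_P1_le.
  have -> : value_P2 N f0 f = value_P N f0 f.
    by apply/eqP; rewrite eq_le value_P2_le.
  by [].
case vE : (value_P N f0 f) value_lty => [v| |] // _; last by rewrite !leNye.
split.
  apply: le_ereal_inf_tmp => _ [z [fz zlim zsup] <-].
  exact: (value_P1_lower f0_convex f_convex f_proper rho0 d0 fxb f_ball vE fz N1).
apply: le_ereal_inf_tmp => _ [z [fz zE] <-].
exact: (value_P2_lower f0_convex f_convex f_proper rho0 d0 fxb f_ball vE fz).
Qed.
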